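(* Any generalized quasi-Sasaki manifold $(M^5,g,\xi,\eta,\varphi)$, with fundamental form $\Phi$ and Nijenhuis tensor $N$, admits a unique metric connection $\nabla^c$ that is compatible with the underlying almost contact metric structure. The connection $\nabla^c$ satisfies $$g(\nabla^c_XY,Z)=g(\nabla^g_XY,Z)+\frac12\Big\{\big((d\eta-\gamma)\wedge\eta\big)(X,Y,Z)-N(X,Y,Z)\Big\},$$ where $\gamma$ is a $2$-form given by $$\gamma(X,Y):=d\Phi(\xi,\varphi(X),Y)=N(\varphi(X),\varphi(Y),\xi).$$ Moreover, the torsion tensor of $\nabla^c$ is a) totally skew-symmetric if and only if $N$ is totally skew-symmetric; in this case $N(X,Y,Z)+(\gamma\wedge\eta)(X,Y,Z)=0$; b) traceless cyclic if and only if $d\eta=\gamma$; in this case $N$ is traceless cyclic.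
   Context: An almost contact metric structure on a Riemannian $5$-manifold $(M^5,g)$ is a triple $(\xi,\eta,\varphi)$: a unit vector field $\xi$, its dual $1$-form $\eta$, and an endomorphism $\varphi$ of $TM^5$ with $\varphi(\xi)=0$, $\varphi^2=-\mathrm{Id}+\eta\otimes\xi$, $g(\varphi(X),\varphi(Y))=g(X,Y)-\eta(X)\eta(Y)$. Its fundamental form is $\Phi(X,Y):=g(X,\varphi(Y))$. Here $\nabla^g$ is the Levi-Civita connection, $(e_1,\dots,e_5)$ denotes a local orthonormal frame ($TM^5$ is identified with its dual via $g$), $d\alpha=\sum_i e_i\wedge\nabla^g_{e_i}\alpha$, so $d\eta(X,Y)=(\nabla^g_X\eta)(Y)-(\nabla^g_Y\eta)(X)$, and $(\beta\wedge\eta)(X,Y,Z)=\beta(X,Y)\eta(Z)+\beta(Y,Z)\eta(X)+\beta(Z,X)\eta(Y)$ for a $2$-form $\beta$. The Nijenhuis tensor is the $(3,0)$-tensor $$N(X,Y,Z):=g(X,[\varphi,\varphi](Y,Z))+\eta(X)\,d\eta(Y,Z),$$ $$[\varphi,\varphi](X,Y)=[\varphi(X),\varphi(Y)]+\varphi^2([X,Y])-\varphi([\varphi(X),Y])-\varphi([X,\varphi(Y)]).$$ A generalized quasi-Sasaki manifold is an almost contact metric $5$-manifold such that (i) $N(X,Y,Z)=0$ and $d\Phi(X,Y,Z)=0$ for all $X,Y,Z$ orthogonal to $\xi$; (ii) $\xi$ is a Killing vector field for $g$. Let $\mathcal A:=\Lambda^1\otimes\Lambda^2$ ($(3,0)$-tensors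 skew-symmetric in the last two arguments); $N\in\mathcal A$. A tensor $A\in\mathcal A$ is totally skew-symmetric if $A(X,Y,Z)+A(Y,X,Z)=0$; it is traceless cyclic if $A(X,Y,Z)+A(Y,Z,X)+A(Z,X,Y)=0$ and $\sum_iA(e_i,e_i,X)=0$. A metric connection $\nabla$ is written $g(\nabla_XY,Z)=g(\nabla^g_XY,Z)+A(X,Y,Z)$ with $A\in\mathcal A$; its torsion tensor is $T(X,Y,Z)=g(\nabla_XY-\nabla_YX-[X,Y],Z)=A(X,Y,Z)-A(Y,X,Z)$, and $T$ is called totally skew-symmetric (resp. traceless cyclic) if $A$ is; equivalently if $T(X,Y,Z)+T(X,Z,Y)=0$ (resp. if $T(X,Y,Z)+T(Y,Z,X)+T(Z,X,Y)=0$ and $\sum_iT(X,e_i,e_i)=0$). The connection $\nabla$ is compatible with the almost contact metric structure if $\nabla\xi=0$, $\nabla\eta=0$, $\nabla\varphi=0$.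
   Formalization: Uniqueness is stated only among compatible metric connections whose tensor A has A + N/2 totally skew-symmetric; compatibility alone never determines the connection, since adding η⊗φ to one gives another. *)

(* Defs.v *)
From HB Require Import structures.
From mathcomp Require Import all_boot all_order all_algebra.
From mathcomp Require Import all_classical all_reals all_analysis.
From mathcomp Require Import lra.

Set Implicit Arguments.
Unset Strict Implicit.
Unset Printing Implicit Defensive.

Import Order.TTheory GRing.Theory Num.Theory numFieldNormedType.Exports.
Local Open Scope classical_set_scope.
Local Open Scope ring_scope.

Section SmoothOn.
Variables (R : realType) (n : nat).
Implicit Types (D : set 'rV[R]_n) (f g : 'rV[R]_n -> R).

Definition partial (i : 'I_n) f : 'rV[R]_n -> R :=
  fun x => 'D_(delta_mx 0 i) f x.

(* C^k on D; only used for open D. *)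
Fixpoint Ck_on (k : nat) D f : Prop :=
  (forall x, D x -> {for x, continuous f}) /\
  match k with
  | 0 => True
  | k'.+1 => forall i : 'I_n,
      (forall x, D x -> derivable f x (delta_mx 0 i)) /\
      Ck_on k' D (partial i f)
  end.

Definition smooth_on D f : Prop := forall k, Ck_on k D f.

Lemma Ck_on_ext k D f g : open D -> (forall x, D x -> f x = g x) ->
  Ck_on k D f -> Ck_on k D g.
Proof.
move=> oD; elim: k f g => [|k IH] f g fg.
all: have nfg x : D x -> \forall y \near x, f y = g y
  by move=> Dx; apply: filterS (fg) _; exact: open_nbhs_nbhs.
all: have cg : (forall x, D x -> {for x, continuous f}) ->
    forall x, D x -> {for x, continuous g}
  by move=> cf x Dx; rewrite /prop_for /continuous_at -(fg _ Dx);
     apply: cvg_trans (cf x Dx);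
     exact: (@near_eq_cvg _ _ (nbhs x) _ f g (nfg _ Dx)).
  by move=> [/cg].
move=> [/cg cg' df]; split=> // i; have [di ci] := df i; split.
  move=> x Dx; apply: near_eq_derivable (di x Dx); exact: nfg.
apply: IH ci => x Dx; apply: near_eq_derive; exact: nfg.
Qed.

Lemma Ck_on_pred k D f : Ck_on k.+1 D f -> Ck_on k D f.
Proof.
elim: k f => [|k IH] f [cf df]; split=> // i.
by have [di ci] := df i; split=> //; exact: IH.
Qed.

Lemma Ck_on_cst k D (a : R) : open D -> Ck_on k D (cst a).
Proof.
move=> oD; elim: k a => [|k IH] a.
  by split=> // x _; exact: cst_continuous.
split=> [x _|i]; first exact: cst_continuous.
split=> [x _|]; first exact: derivable_cst.
by apply: Ck_on_ext (IH 0) => // x _; rewrite /partial derive_cst.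
Qed.

Lemma Ck_on_add k D f g : open D ->
  Ck_on k D f -> Ck_on k D g -> Ck_on k D (f + g).
Proof.
move=> oD; elim: k f g => [|k IH] f g [cf df] [cg dg].
  by split=> // x Dx; exact: (continuousD (cf _ Dx) (cg _ Dx)).
split=> [x Dx|i]; first by exact: (continuousD (cf _ Dx) (cg _ Dx)).
have [dfi cfi] := df i; have [dgi cgi] := dg i.
split=> [x Dx|]; first by apply: derivableD; [exact: dfi|exact: dgi].
apply: Ck_on_ext (IH _ _ cfi cgi) => // x Dx.
by rewrite /partial deriveD //; [exact: dfi|exact: dgi].
Qed.

Lemma Ck_on_mul k D f g : open D ->
  Ck_on k D f -> Ck_on k D g -> Ck_on k D (f * g).
Proof.
move=> oD; elim: k f g => [|k IH] f g Cf Cg; move: (Cf) (Cg) => [cf df] [cg dg].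
  by split=> // x Dx; exact: (continuousM (cf _ Dx) (cg _ Dx)).
split=> [x Dx|i]; first by exact: (continuousM (cf _ Dx) (cg _ Dx)).
have [dfi cfi] := df i; have [dgi cgi] := dg i.
split=> [x Dx|]; first by apply: derivableM; [exact: dfi|exact: dgi].
apply: Ck_on_ext (Ck_on_add oD (IH _ _ (Ck_on_pred Cf) cgi)
                               (IH _ _ (Ck_on_pred Cg) cfi)) => // x Dx.
by rewrite /partial deriveM //; [exact: dfi|exact: dgi].
Qed.

End SmoothOn.

Record chart (R : realType) (n : nat) (M : topologicalType) := Chart {
  chart_dom : set M;
  chart_map : M -> 'rV[R]_n;
  chart_inv : 'rV[R]_n -> M;
  chart_dom_open : open chart_dom;
  chart_img_open : open (chart_map @` chart_dom);
  chart_map_cont : forall x, chart_dom x -> {for x, continuous chart_map};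
  chart_inv_cont : forall y, (chart_map @` chart_dom) y ->
    {for y, continuous chart_inv};
  chart_mapK : forall x, chart_dom x -> chart_inv (chart_map x) = x }.

Arguments chart_dom_open {R n M}.
Arguments chart_img_open {R n M}.

Definition chart_img R n M (c : @chart R n M) : set 'rV[R]_n :=
  chart_map c @` chart_dom c.

Record smooth_manifold (R : realType) (n : nat) := SmoothManifold {
  manifold_carrier :> topologicalType;
  atlas : set (chart R n manifold_carrier);
  manifold_hausdorff : hausdorff_space manifold_carrier;
  manifold_second_countable : @second_countable manifold_carrier;
  atlas_cover : forall x, exists2 c, atlas c & chart_dom c x;
  atlas_compat : forall c d, atlas c -> atlas d -> forall i : 'I_n,
    smooth_on (chart_map c @` (chart_dom c `&` chart_dom d))
              (fun y => chart_map d (chart_inv c y) 0 i) }.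

Section SmoothFunctions.
Variables (R : realType) (n : nat) (M : smooth_manifold R n).

Definition smooth : {pred M -> R} := fun f : M -> R =>
  `[< forall c, atlas (s := M) c ->
        smooth_on (chart_img c) (f \o chart_inv c) >].

Lemma smoothP (f : M -> R) : reflect (forall c, atlas (s := M) c ->
  smooth_on (chart_img c) (f \o chart_inv c)) (f \in smooth).
Proof. exact: asboolP. Qed.

Lemma smooth_cst (a : R) : (cst a : M -> R) \in smooth.
Proof. by apply/smoothP => c _ k; apply: Ck_on_cst; exact: chart_img_open. Qed.

Lemma smoothD (f g : M -> R) : f \in smooth -> g \in smooth -> f + g \in smooth.
Proof.
move=> /smoothP sf /smoothP sg; apply/smoothP => c ac k.
have -> : (f + g) \o chart_inv c = (f \o chart_inv c) + (g \o chart_inv c) by [].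
exact: (Ck_on_add (chart_img_open c) (sf c ac k) (sg c ac k)).
Qed.

Lemma smoothM (f g : M -> R) : f \in smooth -> g \in smooth -> f * g \in smooth.
Proof.
move=> /smoothP sf /smoothP sg; apply/smoothP => c ac k.
have -> : (f * g) \o chart_inv c = (f \o chart_inv c) * (g \o chart_inv c) by [].
exact: (Ck_on_mul (chart_img_open c) (sf c ac k) (sg c ac k)).
Qed.

Lemma smoothZ (a : R) (f : M -> R) : f \in smooth -> a *: f \in smooth.
Proof. by move=> sf; apply: (smoothM (smooth_cst a) sf). Qed.

Lemma smooth_subring : subring_closed smooth.
Proof.
split=> [|f g sf sg|]; [exact: smooth_cst| |exact: smoothM].
by apply: smoothD => //; rewrite -scaleN1r; exact: smoothZ.
Qed.

Lemma smooth_submod : submod_closed smooth.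
Proof.
split=> [|a f g sf sg]; first exact: smooth_cst.
by apply: smoothD => //; exact: smoothZ.
Qed.

HB.instance Definition _ := GRing.isSubringClosed.Build _ smooth smooth_subring.
HB.instance Definition _ := GRing.isSubmodClosed.Build _ _ smooth smooth_submod.

Record Cinf := MkCinf { Cinf_fun :> M -> R; _ : Cinf_fun \in smooth }.

HB.instance Definition _ := [isSub of Cinf for Cinf_fun].
HB.instance Definition _ := [Choice of Cinf by <:].
HB.instance Definition _ := 
  GRing.SubChoice_isSubComPzRing.Build _ _ Cinf (subringClosedP _).
HB.instance Definition _ := [SubZmodule_isSubLmodule of Cinf by <:].

Lemma Cinf_scalerAl (a : R) (f g : Cinf) : a *: (f * g) = (a *: f) * g.
Proof. by apply/val_inj/funext => x; exact: mulrA. Qed.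

Lemma Cinf_scalerAr (a : R) (f g : Cinf) : a *: (f * g) = f * (a *: g).
Proof. by rewrite mulrC Cinf_scalerAl mulrC. Qed.

End SmoothFunctions.

Section VectorFields.
Variables (R : realType) (n : nat) (M : smooth_manifold R n).
Local Notation C := (Cinf M).

(* Vector fields are the derivations of the R-algebra C^oo(M), tensor fields
   are the C^oo(M)-multilinear maps on vector fields. *)
Definition derivation : {pred C -> C^o} := fun X : C -> C =>
  `[< linear X /\ forall f g : C, X (f * g) = X f * g + f * X g >].

Lemma derivationP (X : C -> C) : reflect
  (linear X /\ forall f g : C, X (f * g) = X f * g + f * X g)
  ((X : C -> C^o) \in derivation).
Proof. exact: asboolP. Qed.

Lemma derivation_submod : submod_closed derivation.
Proof.
split=> [|h X Y /derivationP[lX dX] /derivationP[lY dY]]; apply/derivationP.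
  by split=> [a f g|f g]; rewrite /= ?scaler0 ?mul0r ?mulr0 addr0.
have E f : (h *: X + Y) f = h * X f + Y f by [].
split=> [a f g|f g]; rewrite !E ?lX ?lY ?dX ?dY.
  by rewrite mulrDr scalerDr -Cinf_scalerAr addrACA.
by rewrite !mulrDr !mulrDl !mulrA (mulrC f h) addrACA.
Qed.

Record vfield := MkVfield { vfield_fun :> C -> C; _ : vfield_fun \in derivation }.

HB.instance Definition _ := [isSub of vfield for vfield_fun].
HB.instance Definition _ := [Choice of vfield by <:].
HB.instance Definition _ := 
  GRing.SubChoice_isSubLmodule.Build C (C -> C^o) derivation vfield
    (GRing.submod_closed_semi derivation_submod).

Lemma vfield_linear (X : vfield) : linear X.
Proof. by have /derivationP[] := valP X. Qed.

Lemma vfieldM (X : vfield) (f g : C) : X (f * g) = X f * g + f * X g.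
Proof. by have /derivationP[_] := valP X. Qed.

Lemma bracket_subproof (X Y : vfield) :
  (fun f => X (Y f) - Y (X f)) \in derivation.
Proof.
apply/derivationP; split=> [a f g|f g].
  by rewrite !vfield_linear opprD scalerBr addrACA.
have D (Z : vfield) u v : Z (u + v) = Z u + Z v.
  by rewrite -[u]scale1r vfield_linear !scale1r.
rewrite !(vfieldM, D) mulrBl mulrBr [X in _ - X]addrACA.
rewrite [X in _ - (X + _)]addrC [X in _ - X]addrACA [X in _ - (X + _)]addrC.
rewrite opprD addrACA.
rewrite !opprD (addrACA (X (Y f) * g)) subrr addr0 (addrACA (X f * Y g)).
by rewrite (addrA (_ - _)) (addrA (_ - _)) subrK.
Qed.

Definition bracket (X Y : vfield) : vfield := MkVfield (bracket_subproof X Y).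

End VectorFields.

Section Tensors.
Variables (R : realType) (n : nat) (M : smooth_manifold R n).
Local Notation C := (Cinf M).
Local Notation X := (vfield M).
Implicit Types (x y z : X) (f : C) (p q : M).

Definition one_form (a : X -> C) : Prop :=
  forall (f : C) x y, a (f *: x + y) = f * a x + a y.

Definition endomorphism (p : X -> X) : Prop :=
  forall (f : C) x y, p (f *: x + y) = f *: p x + p y.

Definition two_form (b : X -> X -> C) : Prop :=
  (forall z, one_form (b^~ z)) /\ (forall x y, b x y = - b y x).

Record riemannian_metric := RiemannianMetric {
  metric_fun :> X -> X -> C;
  metric_sym : forall x y, metric_fun x y = metric_fun y x;
  metric_linear : forall z, one_form (metric_fun^~ z);
  metric_ge0 : forall x (p : M), 0 <= metric_fun x x p;
  (* The right-hand side says that the tangent vector of x at p is zero. *)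
  metric_eq0 : forall x (p : M),
    metric_fun x x p = 0 <-> forall f : C, x f p = 0 }.

Definition connection (D : X -> X -> X) : Prop :=
  [/\ forall y, endomorphism (D^~ y),
      forall x y z, D x (y + z) = D x y + D x z
    & forall x (f : C) y, D x (f *: y) = x f *: y + f *: D x y].

Definition metric_connection (g : riemannian_metric) (D : X -> X -> X) : Prop :=
  connection D /\ forall x y z, x (g y z) = g (D x y) z + g y (D x z).

Definition levi_civita (g : riemannian_metric) (D : X -> X -> X) : Prop :=
  metric_connection g D /\ forall x y, D x y - D y x = bracket x y.

Definition nabla_one (D : X -> X -> X) (a : X -> C) x y : C :=
  x (a y) - a (D x y).

Definition nabla_two (D : X -> X -> X) (b : X -> X -> C) x y z : C :=
  x (b y z) - b (D x y) z - b y (D x z).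

Definition nabla_endo (D : X -> X -> X) (p : X -> X) x y : X :=
  D x (p y) - p (D x y).

(* d a = \sum_i e_i /\ nabla_(e_i) a, for D the Levi-Civita connection. *)
Definition d_one (D : X -> X -> X) (a : X -> C) x y : C :=
  nabla_one D a x y - nabla_one D a y x.

Definition d_two (D : X -> X -> X) (b : X -> X -> C) x y z : C :=
  nabla_two D b x y z + nabla_two D b y z x + nabla_two D b z x y.

Definition wedge21 (b : X -> X -> C) (a : X -> C) x y z : C :=
  b x y * a z + b y z * a x + b z x * a y.

(* L_x g = 0. *)
Definition killing (g : riemannian_metric) (x : X) : Prop :=
  forall y z, x (g y z) = g (bracket x y) z + g y (bracket x z).

(* Local frames on U are given by the restrictions to U of vector fields on M;
   the second condition says that the tangent vectors of the e_i at q span. *)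
Definition orthonormal_frame (g : riemannian_metric) (U : set M)
    (e : 'I_n -> X) : Prop :=
  forall q, U q ->
    (forall i j, g (e i) (e j) q = (i == j)%:R) /\
    (forall x (f : C), x f q = \sum_i g x (e i) q * e i f q).

(* The next two predicates are only used for tensors A(x, y, z) that are skew in
   y and z. *)
Definition totally_skew (A : X -> X -> X -> C) : Prop :=
  forall x y z, A x y z + A y x z = 0.

Definition traceless_cyclic (g : riemannian_metric) (A : X -> X -> X -> C) :
    Prop :=
  (forall x y z, A x y z + A y z x + A z x y = 0) /\
  (forall U e, open U -> orthonormal_frame g U e ->
     forall x q, U q -> \sum_i A (e i) (e i) x q = 0).

Definition torsion (g : riemannian_metric) (D : X -> X -> X) x y z : C :=
  g (D x y - D y x - bracket x y) z.

(* The torsion tensor lies in Lambda^2 (x) Lambda^1, so its symmetry types are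
   stated with the arguments in a different order than those of A. *)
Definition torsion_totally_skew (T : X -> X -> X -> C) : Prop :=
  forall x y z, T x y z + T x z y = 0.

Definition torsion_traceless_cyclic (g : riemannian_metric)
    (T : X -> X -> X -> C) : Prop :=
  (forall x y z, T x y z + T y z x + T z x y = 0) /\
  (forall U e, open U -> orthonormal_frame g U e ->
     forall x q, U q -> \sum_i T x (e i) (e i) q = 0).

Definition difference_tensor (g : riemannian_metric) (Dg D : X -> X -> X)
    x y z : C := g (D x y) z - g (Dg x y) z.

Lemma CinfP (f h : C) : (forall p : M, f p = h p) -> f = h.
Proof. by move=> fh; apply/val_inj/funext. Qed.

Lemma Cinf_at p (f h : C) : f = h -> f p = h p.
Proof. by move->. Qed.

Lemma CinfDE (f h : C) p : (f + h) p = f p + h p.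
Proof. by []. Qed.

Lemma CinfNE (f : C) p : (- f) p = - f p.
Proof. by []. Qed.

Lemma Cinf0E p : (0 : C) p = 0.
Proof. by []. Qed.

Definition CinfE := (CinfDE, CinfNE, Cinf0E).

Lemma metricDl (g : riemannian_metric) x y z : g (x + y) z = g x z + g y z.
Proof. by rewrite -{1}[x]scale1r metric_linear mul1r. Qed.

Lemma metricBl (g : riemannian_metric) x y z : g (x - y) z = g x z - g y z.
Proof. by rewrite addrC -scaleN1r metric_linear mulN1r addrC. Qed.

Section TorsionTypes.
Variables (g : riemannian_metric) (Dg D : X -> X -> X).
Hypotheses (hDg : levi_civita g Dg) (hD : metric_connection g D).
Let A := difference_tensor g Dg D.
Let T := torsion g D.

Lemma difference_tensor_skew x y z p : A x y z p = - A x z y p.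
Proof.
have [[_ mg] _] := hDg; have [_ mD] := hD.
have /(Cinf_at p) : g (D x y) z + g y (D x z) =
  g (Dg x y) z + g y (Dg x z) by rewrite -mg -mD.
rewrite (metric_sym g y) (metric_sym g y (Dg x z)) /A /difference_tensor !CinfE; lra.
Qed.

Lemma torsionE x y z p : T x y z p = A x y z p - A y x z p.
Proof.
have [_ tg] := hDg.
by rewrite /T /torsion -tg !metricBl /A /difference_tensor !CinfE !opprD addrACA.
Qed.

Lemma torsion_totally_skewP : torsion_totally_skew T <-> totally_skew A.
Proof.
move: A T difference_tensor_skew torsionE => B S skewB SE.
split=> H x y z; apply: CinfP => p; rewrite !CinfE.
  have E a b c : B b a c p + B c a b p = 0.
    have /(Cinf_at p) := H a b c.
    rewrite !CinfE !SE; have := skewB a b c p; lra.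
  have := E y x z; have := E z x y; have := E x y z.
  have := skewB x y z p; have := skewB y x z p.
  have := skewB z x y p; lra.
have E a b c : B a b c p + B b a c p = 0.
  by have /(Cinf_at p) := H a b c.
rewrite !SE.
have := E x y z; have := E x z y; have := E y z x.
have := skewB x y z p; have := skewB y x z p.
have := skewB z x y p; lra.
Qed.

Lemma torsion_traceless_cyclicP :
  torsion_traceless_cyclic g T <-> traceless_cyclic g A.
Proof.
move: A T difference_tensor_skew torsionE => B S skewB SE.
have tr x (e : 'I_n -> X) q :
    \sum_i S x (e i) (e i) q = \sum_i B (e i) (e i) x q.
  apply: eq_bigr => i _; rewrite SE.
  have := skewB x (e i) (e i) q.
  have := skewB (e i) (e i) x q; lra.
have cyc x y z p : S x y z p + S y z x p + S z x y p =
    2 * (B x y z p + B y z x p + B z x y p).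
  rewrite !SE.
  have := skewB x y z p; have := skewB y x z p.
  have := skewB z x y p; lra.
split=> -[H1 H2]; split=> [x y z|U e oU fe x q Uq].
- apply: CinfP => p; have /(Cinf_at p) := H1 x y z.
  by rewrite !CinfE cyc; lra.
- by rewrite -tr; exact: H2 oU fe x q Uq.
- apply: CinfP => p; have /(Cinf_at p) := H1 x y z.
  by rewrite !CinfE cyc; lra.
- by rewrite tr; exact: H2 oU fe x q Uq.
Qed.

End TorsionTypes.

End Tensors.

Section AlmostContact.
Variables (R : realType) (n : nat) (M : smooth_manifold R n).
Local Notation C := (Cinf M).
Local Notation X := (vfield M).
Implicit Types (x y z : X) (f : C) (p q : M).

Record almost_contact_metric (g : riemannian_metric M) := AlmostContactMetric {
  acm_xi : X;
  acm_eta : X -> C;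
  acm_phi : X -> X;
  xi_unit : g acm_xi acm_xi = 1;
  eta_dual : forall x, acm_eta x = g x acm_xi;
  phi_linear : endomorphism acm_phi;
  phi_xi : acm_phi acm_xi = 0;
  phi_phi : forall x, acm_phi (acm_phi x) = - x + acm_eta x *: acm_xi;
  phi_metric : forall x y,
    g (acm_phi x) (acm_phi y) = g x y - acm_eta x * acm_eta y }.

Variables (g : riemannian_metric M) (S : almost_contact_metric g).
Variable Dg : X -> X -> X.
Local Notation xi := (acm_xi S).
Local Notation eta := (acm_eta S).
Local Notation phi := (acm_phi S).

Definition fundamental_form x y : C := g x (phi y).

Definition phi_bracket x y : X :=
  bracket (phi x) (phi y) + phi (phi (bracket x y))
  - phi (bracket (phi x) y) - phi (bracket x (phi y)).

Definition nijenhuis x y z : C :=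
  g x (phi_bracket y z) + eta x * d_one Dg eta y z.

Definition generalized_quasi_sasaki : Prop :=
  (forall x y z, g x xi = 0 -> g y xi = 0 -> g z xi = 0 ->
     nijenhuis x y z = 0 /\ d_two Dg fundamental_form x y z = 0) /\
  killing g xi.

Definition compatible (D : X -> X -> X) : Prop :=
  [/\ forall x, D x xi = 0,
      forall x y, nabla_one D eta x y = 0
    & forall x y, nabla_endo D phi x y = 0].

Definition gamma x y : C := d_two Dg fundamental_form xi (phi x) y.

(* Adding eta (x) phi to a compatible metric connection gives another one:
   compatibility alone does not determine a metric connection, and uniqueness
   needs a normalization, see skew_modulo_nijenhuis. *)
Lemma compatible_shift (D : X -> X -> X) :
  metric_connection g D -> compatible D ->
  let D' := fun x y => D x y + eta x *: phi y in
  metric_connection g D' /\ compatible D'.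
Proof.
move=> [[Dl Dr DL] Dm] [Dxi Deta Dphi] D'.
have phiDl x y : phi (x + y) = phi x + phi y.
  by rewrite -{1}[x]scale1r phi_linear scale1r.
have phi0 : phi 0 = 0.
  by apply: (addrI (phi 0)); rewrite -phiDl !addr0.
have phiZ f x : phi (f *: x) = f *: phi x.
  by rewrite -[f *: x]addr0 phi_linear phi0 addr0.
have g0 z : g 0 z = 0.
  by apply: (addrI (g 0 z)); rewrite -metricDl !addr0.
have gZ f x z : g (f *: x) z = f * g x z.
  by rewrite -[f *: x]addr0 metric_linear g0 addr0.
have gN x z : g (- x) z = - g x z by rewrite -scaleN1r gZ mulN1r.
have phixi : phi xi = 0 := phi_xi S.
have etaphi y : eta (phi y) = 0.
  have H : phi (phi (phi y)) = - phi y + eta (phi y) *: xi by exact: phi_phi.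
  have H' : phi (phi (phi y)) = - phi y.
    rewrite (phi_phi S y) phiDl phiZ phixi scaler0 addr0.
    by rewrite -scaleN1r phiZ scaleN1r.
  have {H H'} /(congr1 (fun u => g u xi)) : eta (phi y) *: xi = 0.
    by apply: (addrI (- phi y)); rewrite -H H' addr0.
  by rewrite gZ xi_unit mulr1 g0.
have skew y z : g (phi y) z = - g y (phi z).
  have := phi_metric S y (phi z).
  rewrite etaphi mulr0 subr0 => <-; rewrite phi_phi metric_sym.
  rewrite (metric_sym g (phi y) (_ + _)) metricDl gN gZ.
  by rewrite (metric_sym g xi) -(eta_dual S) etaphi mulr0 addr0 opprK metric_sym.
split; first split.
- split=> [y f x x'|x y z|x f y]; rewrite /D'.
  + rewrite Dl (eta_dual S) metric_linear -!(eta_dual S).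
    by rewrite scalerDl scalerDr scalerA addrACA.
  + by rewrite Dr phiDl scalerDr addrACA.
  + by rewrite DL phiZ scalerDr !scalerA mulrC addrA.
- move=> x y z; rewrite Dm /D' metricDl gZ (metric_sym g y (_ + _)) metricDl gZ.
  rewrite (metric_sym g (phi z)) skew (metric_sym g (D x z)) mulrN.
  by rewrite addrACA addNr addr0.
split=> [x|x y|x y]; rewrite /D'.
- by rewrite Dxi phixi scaler0 addr0.
- rewrite /nabla_one -[RHS](Deta x y) /nabla_one.
  by rewrite !(eta_dual S) metricDl gZ -!(eta_dual S) etaphi mulr0 addr0.
- by rewrite /nabla_endo phiDl phiZ opprD addrACA subrr addr0; exact: Dphi.
Qed.

(* The difference tensor A to the Levi-Civita connection is a 3-form minus N/2.
   When N is totally skew-symmetric this says that the torsion is a 3-form. *)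
Definition skew_modulo_nijenhuis (D : X -> X -> X) : Prop :=
  totally_skew (fun x y z =>
    difference_tensor g Dg D x y z + (2^-1 : R) *: nijenhuis x y z).

End AlmostContact.

(* Main.v *)
(* Let psi X = nabla_X xi, which is skew with psi xi = 0 because xi is a unit
   Killing field, and P = nabla_xi phi, which is skew and anticommutes with phi.
   Condition (i) says that the structure is transversally Kaehler: the
   horizontal part of nabla phi vanishes, so that
     (nabla_X phi) Y = eta(X) P Y - eta(Y) phi psi X + g(phi psi X, Y) xi.
   Hence N, d eta and gamma are all expressed by psi, P and phi: with the
   operator Gamma of the 2-form gamma,
     Gamma = - P phi - phi psi phi - psi,   d eta(X, Y) = 2 g(psi X, Y),
     N(X, Y, Z) = 2 eta(X) g((phi psi phi + psi) Y, Z)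
                  - eta(Y) gamma(Z, X) - eta(Z) gamma(X, Y),
   and every claim except uniqueness becomes an identity between skew operators.
   For instance, the torsion is cyclic iff 5 psi = phi psi phi + phi P;
   conjugating this by phi gives psi = phi psi phi = phi P / 4, that is,
   2 psi = Gamma. *)
Require Import Defs.
From mathcomp Require Import all_boot all_order all_algebra.
From mathcomp Require Import all_classical all_reals all_analysis.
From mathcomp Require Import ring lra.
Import Order.TTheory GRing.Theory Num.Theory.

Set Implicit Arguments.
Unset Strict Implicit.
Unset Printing Implicit Defensive.

Local Open Scope ring_scope.

(** * Pointwise algebra of the metric, its nondegeneracy, and frame expansions *)

Section MetricAlgebra.
Variables (R : realType) (n : nat) (M : smooth_manifold R n).
Variable g : riemannian_metric M.
Implicit Types (x y z : vfield M) (f h : Cinf M) (p q : M).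

Lemma CinfME f h p : (f * h) p = f p * h p.
Proof. by []. Qed.

Lemma CinfZE (a : R) f p : (a *: f) p = a * f p.
Proof. by []. Qed.

Lemma Cinf1E p : (1 : Cinf M) p = 1.
Proof. by []. Qed.

Definition CinfrE := (CinfDE, CinfNE, Cinf0E, CinfME, CinfZE, Cinf1E).

Lemma metricC x y : g x y = g y x.
Proof. exact: Defs.metric_sym. Qed.

Lemma metric0l z : g 0 z = 0.
Proof. by rewrite -(subrr 0) metricBl subrr. Qed.

Lemma metricZl f x z : g (f *: x) z = f * g x z.
Proof. by rewrite -[f *: x]addr0 metric_linear metric0l addr0. Qed.

Lemma metricNl x z : g (- x) z = - g x z.
Proof. by rewrite -sub0r metricBl metric0l sub0r. Qed.

Lemma metric0r z : g z 0 = 0.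
Proof. by rewrite metricC metric0l. Qed.

Lemma metricDr x y z : g x (y + z) = g x y + g x z.
Proof. by rewrite !(metricC x) metricDl. Qed.

Lemma metricZr f x z : g z (f *: x) = f * g z x.
Proof. by rewrite !(metricC z) metricZl. Qed.

Lemma metricNr x z : g z (- x) = - g z x.
Proof. by rewrite !(metricC z) metricNl. Qed.

Definition metricE := (metricDl, metricDr, metricZl, metricZr,
  metricNl, metricNr, metric0l, metric0r).

(** The value of g at p depends only on tangent vectors at p. Vector fields are derivations, so this
    is drawn from positivity, by a Cauchy-Schwarz argument on g(x + t y, x + t y) at p. *)
Lemma metric_at_eq0 x y p : (forall f, x f p = 0) -> g x y p = 0.
Proof.
move=> /metric_eq0 gx.
have ge0 (t : R) : 0 <= t * (2 * g x y p + t * g y y p).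
  have := metric_ge0 g (x + (t *: (1 : Cinf M)) *: y) p.
  rewrite !metricE (metricC y x) !CinfrE gx.
  by move=> ?; lra.
have yy := metric_ge0 g y p.
have [a0|] := eqVneq (g y y p) 0.
  by have := ge0 1; have := ge0 (-1); rewrite a0; lra.
(* This t minimizes the quadratic polynomial in [ge0]. *)
move=> a0; have := ge0 (- (g x y p / g y y p)).
set a := g y y p in a0 yy *; set b := g x y p.
have -> : - (b / a) * (2 * b + - (b / a) * a) = - (b ^+ 2 / a) by field.
rewrite oppr_ge0 => ba.
have apos : 0 < a by rewrite lt_neqAle eq_sym a0.
move: ba; rewrite pmulr_lle0 ?invr_gt0// => b2.
by apply/eqP; rewrite -sqrf_eq0 eq_le b2 sqr_ge0.
Qed.

(** Nondegeneracy. It reduces equations between vector fields to identities of real numbers, which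
    [lra] can close. *)
Lemma metric_ext x y : (forall z p, g x z p = g y z p) -> x = y.
Proof.
move=> xy; apply/val_inj/funext => f; apply: CinfP => p.
have /metric_eq0/(_ f) : g (x - y) (x - y) p = 0.
  by rewrite metricBl CinfDE CinfNE xy subrr.
rewrite (_ : (x - y) f p = x f p - y f p)//; lra.
Qed.

(** The frame expands only the tangent vector of x at q, not the field x itself; [metric_at_eq0]
    carries the expansion over to g at q. *)
Lemma orthonormal_frame_metric U (e : 'I_n -> vfield M) x y q :
  orthonormal_frame g U e -> U q ->
  g x y q = \sum_i g x (e i) q * g (e i) y q.
Proof.
move=> fe Uq; have [_ sp] := fe q Uq.
have sumE (r : seq 'I_n) f :
    (\sum_(i <- r) g x (e i) *: e i) f q =
    \sum_(i <- r) g x (e i) q * e i f q.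
  elim: r => [|i r IH]; first by rewrite !big_nil.
  by rewrite !big_cons -IH.
have gsum (r : seq 'I_n) : g (\sum_(i <- r) g x (e i) *: e i) y q =
    \sum_(i <- r) g x (e i) q * g (e i) y q.
  elim: r => [|i r IH]; first by rewrite !big_nil metric0l.
  by rewrite !big_cons -IH !metricE !CinfrE.
rewrite -gsum; apply/eqP; rewrite -subr_eq0; apply/eqP.
rewrite -[LHS]/((g _ _ - g _ _) q) -metricBl; apply: metric_at_eq0 => f.
rewrite -[LHS]/(x f q - (\sum_i g x (e i) *: e i) f q).
by rewrite sumE sp subrr.
Qed.

End MetricAlgebra.

(** * Linearity rules for endomorphisms, connections and covariant derivatives *)

Section Endomorphisms.
Variables (R : realType) (n : nat) (M : smooth_manifold R n).
Variables (u : vfield M -> vfield M) (hu : endomorphism u).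

Lemma endoD x y : u (x + y) = u x + u y.
Proof. by rewrite -{1}[x]scale1r hu scale1r. Qed.

Lemma endo0 : u 0 = 0.
Proof. by apply: (addrI (u 0)); rewrite -endoD !addr0. Qed.

Lemma endoZ f x : u (f *: x) = f *: u x.
Proof. by rewrite -[f *: x]addr0 hu endo0 addr0. Qed.

Lemma endoN x : u (- x) = - u x.
Proof. by rewrite -scaleN1r endoZ scaleN1r. Qed.

Definition endoE := (endoD, endoZ, endoN, endo0).

End Endomorphisms.

Section Connections.
Variables (R : realType) (n : nat) (M : smooth_manifold R n).
Implicit Types (x y z : vfield M).

Lemma vfield_one x : x 1 = 0.
Proof.
have := vfieldM x 1 1; rewrite !mulr1 mul1r => e.
by apply: (addrI (x 1)); rewrite addr0 -e.
Qed.

Lemma vfieldN x f : x (- f) = - x f.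
Proof.
have x0 : x 0 = 0.
  by apply: (addrI (x 0));
    rewrite -{1}[x 0]scale1r -vfield_linear scale1r !addr0.
by rewrite -[in LHS]scaleN1r -[(-1) *: _]addr0 vfield_linear scaleN1r x0 addr0.
Qed.

Variables (D : vfield M -> vfield M -> vfield M) (cD : connection D).

Lemma connectionDr x y z : D x (y + z) = D x y + D x z.
Proof. by have [_ + _] := cD; apply. Qed.

Lemma connectionZr x f y : D x (f *: y) = x f *: y + f *: D x y.
Proof. by have [_ _] := cD; apply. Qed.

Lemma connection0r x : D x 0 = 0.
Proof. by apply: (addrI (D x 0)); rewrite -connectionDr !addr0. Qed.

Lemma connectionNr x y : D x (- y) = - D x y.
Proof. by apply/eqP; rewrite -addr_eq0 -connectionDr addNr connection0r. Qed.

Variables (u : vfield M -> vfield M) (hu : endomorphism u).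

Lemma nabla_endo_linear_l y : endomorphism (fun x => nabla_endo D u x y).
Proof.
have [Dl _ _] := cD; move=> f x x'.
by rewrite /nabla_endo !Dl !(endoE hu) scalerBr opprD addrACA.
Qed.

(** The two Leibniz terms in [x f] cancel. *)
Lemma nabla_endo_linear_r x : endomorphism (nabla_endo D u x).
Proof.
move=> f y y'; rewrite /nabla_endo.
rewrite !(endoE hu) !connectionDr !connectionZr !(endoE hu).
rewrite opprD addrACA; congr (_ + _).
by rewrite opprD addrACA subrr add0r -scalerBr.
Qed.

End Connections.

(** * Almost contact metric identities and the tensors expressed by [nabla_xi] and [nabla_phi] *)

Section AlmostContactGeometry.
Variables (R : realType) (n : nat) (M : smooth_manifold R n).
Variables (g : riemannian_metric M) (Dg : vfield M -> vfield M -> vfield M).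
Hypothesis hDg : levi_civita g Dg.
Variable S : almost_contact_metric g.
Implicit Types (x y z w : vfield M) (f : Cinf M) (p q : M).

Local Notation xi := (acm_xi S).
Local Notation eta := (acm_eta S).
Local Notation phi := (acm_phi S).
Local Notation N := (nijenhuis S Dg).
Local Notation gam := (gamma S Dg).

(* Locked, lest the linearity rules rewrite inside the difference. *)
Definition nabla_phi x y := locked (nabla_endo Dg phi x y).
Local Notation nphi := nabla_phi.

Definition nabla_xi x := Dg x xi.
Local Notation psi := nabla_xi.

Definition nabla_xi_phi y := nphi xi y.
Local Notation P := nabla_xi_phi.

Definition gamma_endo y := locked (- P (phi y) - phi (psi (phi y)) - psi y).
Local Notation Gam := gamma_endo.

(** Vector fields are scaled by functions, so the number 1/2 enters as a constant function. *)
Definition half : Cinf M := (2^-1 : R) *: (1 : Cinf M).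

(** Obtained from the claimed formula by inserting the expressions for d eta, gamma and N and
    raising the index z; the gamma terms with factor eta(y) or eta(z) cancel. *)
Definition canonical_connection x y := Dg x y + g (psi x) y *: xi
  - g y xi *: psi x - g x xi *: (phi (psi (phi y)) + half *: Gam y).
Local Notation Dc := canonical_connection.

Lemma nabla_phiE x y : nphi x y = nabla_endo Dg phi x y.
Proof. by rewrite /nabla_phi -lock. Qed.

Lemma gamma_endoE y : Gam y = - P (phi y) - phi (psi (phi y)) - psi y.
Proof. by rewrite /gamma_endo -lock. Qed.

Let connDg : connection Dg.
Proof. by have [[]] := hDg. Qed.

Lemma lc_metric x y z : x (g y z) = g (Dg x y) z + g y (Dg x z).
Proof. by have [[_ +] _] := hDg; apply. Qed.

Lemma lc_bracket x y : bracket x y = Dg x y - Dg y x.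
Proof. by have [_ ->] := hDg. Qed.

Lemma xi_xi : g xi xi = 1. Proof. exact: xi_unit. Qed.

Let phi_lin : endomorphism phi.
Proof. exact: phi_linear. Qed.

Lemma phiD x y : phi (x + y) = phi x + phi y.
Proof. exact: (endoD phi_lin). Qed.

Lemma phiZ f x : phi (f *: x) = f *: phi x.
Proof. exact: (endoZ phi_lin). Qed.

Lemma phiN x : phi (- x) = - phi x.
Proof. exact: (endoN phi_lin). Qed.

Lemma phi0 : phi 0 = 0.
Proof. exact: (endo0 phi_lin). Qed.

Lemma phi2 x : phi (phi x) = - x + g x xi *: xi.
Proof. by rewrite phi_phi eta_dual. Qed.

Definition phiE := (phiD, phiZ, phiN, phi0, phi_xi S).

Lemma phi3 x : phi (phi (phi x)) = - phi x.
Proof. by rewrite (phi2 x) !phiE scaler0 addr0. Qed.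

(** Compare the cube of [phi] computed as [phi] after its square and as its square after [phi]. *)
Lemma phi_horizontal x : g (phi x) xi = 0.
Proof.
have /(congr1 (fun u => g u xi)) := phi2 (phi x).
rewrite phi3 !metricE xi_xi mulr1 => e.
by apply: (addrI (- g (phi x) xi)); rewrite -e addr0.
Qed.

Lemma phi_skew x y : g (phi x) y = - g x (phi y).
Proof.
have := phi_metric S x (phi y); rewrite !eta_dual phi_horizontal mulr0 subr0.
by move=> <-; rewrite phi2 !metricE phi_horizontal mulr0 addr0 opprK.
Qed.

Lemma phi_metricE x y : g (phi x) (phi y) = g x y - g x xi * g y xi.
Proof. by rewrite phi_metric !eta_dual. Qed.

Lemma nabla_xi_linear : endomorphism psi.
Proof. by have [+ _ _] := connDg; apply. Qed.

(** Differentiate g(xi, xi) = 1. *)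
Lemma nabla_xi_horizontal x : g (psi x) xi = 0.
Proof.
apply: CinfP => p.
have /(Cinf_at p) := lc_metric x xi xi.
rewrite xi_xi vfield_one (metricC g xi) -/(psi x) !CinfrE; lra.
Qed.

Lemma d_etaE x y : d_one Dg eta x y = g (psi x) y - g (psi y) x.
Proof.
rewrite /d_one /nabla_one !eta_dual !lc_metric (metricC g y) (metricC g x).
apply: CinfP => p; rewrite /nabla_xi !CinfrE; lra.
Qed.

Lemma nabla_phi_xi x : nphi x xi = - phi (psi x).
Proof.
by rewrite !nabla_phiE /nabla_endo (phi_xi S) (connection0r connDg)
  sub0r.
Qed.

Lemma nabla_phi_skew x y z : g (nphi x y) z = - g y (nphi x z).
Proof.
have := lc_metric x (phi y) z; rewrite phi_skew vfieldN lc_metric => e;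
  apply: CinfP => p; move/(Cinf_at p): e.
rewrite !nabla_phiE /nabla_endo !metricE (phi_skew _ z) (phi_skew y) !CinfrE;
  lra.
Qed.

(** The covariant derivative of phi^2 = - Id + eta (x) xi. At x = xi it will make [P] anticommute
    with [phi]. *)
Lemma nabla_phi_phi x y :
  nphi x (phi y) + phi (nphi x y) = g (psi x) y *: xi + g y xi *: psi x.
Proof.
rewrite !nabla_phiE /nabla_endo !phiE addrA subrK phi_phi eta_dual.
rewrite (connectionDr connDg) (connectionNr connDg) (connectionZr connDg).
rewrite lc_metric phi2.
rewrite scalerDl -/(psi x) (metricC g y (psi x)).
apply: (@metric_ext _ _ _ g) => z p; rewrite !metricE !CinfrE; lra.
Qed.

Lemma phi_bracketE x y : phi_bracket S x y =
  nphi (phi x) y - nphi (phi y) x + phi (nphi y x) - phi (nphi x y).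
Proof.
rewrite /phi_bracket !lc_bracket !nabla_phiE /nabla_endo !phiE.
apply: (@metric_ext _ _ _ g) => z p; rewrite !metricE !CinfrE; lra.
Qed.

Lemma d_fundamentalE x y z : d_two Dg (fundamental_form S) x y z =
  g y (nphi x z) + g z (nphi y x) + g x (nphi z y).
Proof.
rewrite /d_two /nabla_two /fundamental_form !lc_metric !nabla_phiE /nabla_endo.
apply: CinfP => p; rewrite !metricE !CinfrE; lra.
Qed.

Lemma nabla_phiDl x x' y : nphi (x + x') y = nphi x y + nphi x' y.
Proof.
by rewrite !nabla_phiE (endoD (nabla_endo_linear_l connDg phi_lin y)).
Qed.

Lemma nabla_phiZl f x y : nphi (f *: x) y = f *: nphi x y.
Proof.
by rewrite !nabla_phiE (endoZ (nabla_endo_linear_l connDg phi_lin y)).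
Qed.

Lemma nabla_phiNl x y : nphi (- x) y = - nphi x y.
Proof.
by rewrite !nabla_phiE (endoN (nabla_endo_linear_l connDg phi_lin y)).
Qed.

Lemma nabla_phiDr x y y' : nphi x (y + y') = nphi x y + nphi x y'.
Proof.
by rewrite !nabla_phiE (endoD (nabla_endo_linear_r connDg phi_lin x)).
Qed.

Lemma nabla_phiZr f x y : nphi x (f *: y) = f *: nphi x y.
Proof.
by rewrite !nabla_phiE (endoZ (nabla_endo_linear_r connDg phi_lin x)).
Qed.

Lemma nabla_phiNr x y : nphi x (- y) = - nphi x y.
Proof.
by rewrite !nabla_phiE (endoN (nabla_endo_linear_r connDg phi_lin x)).
Qed.

Definition nabla_phi_linE := (nabla_phiDl, nabla_phiZl, nabla_phiNl,
  nabla_phiDr, nabla_phiZr, nabla_phiNr).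

Lemma nabla_xiD x y : psi (x + y) = psi x + psi y.
Proof. exact: (endoD nabla_xi_linear). Qed.

Lemma nabla_xiZ f x : psi (f *: x) = f *: psi x.
Proof. exact: (endoZ nabla_xi_linear). Qed.

Lemma nabla_xiN x : psi (- x) = - psi x.
Proof. exact: (endoN nabla_xi_linear). Qed.

Lemma nabla_xi0 : psi 0 = 0.
Proof. exact: (endo0 nabla_xi_linear). Qed.

(** * Consequences of the quasi-Sasaki conditions for [psi], [P], [gamma] and N *)

Hypothesis hS : generalized_quasi_sasaki S Dg.

(** The Killing equation with its brackets expanded by the torsion-free metric connection. *)
Lemma nabla_xi_skew x y : g (psi x) y = - g x (psi y).
Proof.
have [_ /(_ x y)] := hS; rewrite !lc_bracket lc_metric => e.
apply: CinfP => p; move/(Cinf_at p): e; rewrite !metricE !CinfrE /nabla_xi; lra.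
Qed.

Lemma nabla_xi_xi : psi xi = 0.
Proof.
apply: (@metric_ext _ _ _ g) => z p.
by rewrite nabla_xi_skew metricC nabla_xi_horizontal metric0l oppr0.
Qed.

Definition nabla_xiE := (nabla_xiD, nabla_xiZ, nabla_xiN, nabla_xi0,
  nabla_xi_xi).

Lemma nabla_xi_phi_xi : P xi = 0.
Proof. by rewrite /nabla_xi_phi nabla_phi_xi nabla_xi_xi !phiE oppr0. Qed.

Lemma nabla_xi_phiD x y : P (x + y) = P x + P y.
Proof. exact: nabla_phiDr. Qed.

Lemma nabla_xi_phiZ f x : P (f *: x) = f *: P x.
Proof. exact: nabla_phiZr. Qed.

Lemma nabla_xi_phiN x : P (- x) = - P x.
Proof. exact: nabla_phiNr. Qed.

Lemma nabla_xi_phi_skew x y : g (P x) y = - g x (P y).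
Proof. exact: nabla_phi_skew. Qed.

Lemma nabla_xi_phi_horizontal x : g (P x) xi = 0.
Proof. by rewrite nabla_xi_phi_skew nabla_xi_phi_xi metric0r oppr0. Qed.

Lemma nabla_xi_phi_phi y : P (phi y) = - phi (P y).
Proof.
have := nabla_phi_phi xi y; rewrite nabla_xi_xi metric0l scale0r scaler0 addr0.
by move/eqP; rewrite addr_eq0 => /eqP.
Qed.

Definition nabla_xi_phiE := (nabla_xi_phi_phi, nabla_xi_phiD, nabla_xi_phiZ,
  nabla_xi_phiN, nabla_xi_phi_xi).

(* N = 0 at (phi z, phi x, phi y) and d Phi = 0 at (phi x, phi y, phi (phi z))
   combine to G x y z - G y x z + G z y x = 0, which forces G = 0 because G is
   skew in its last two arguments. *)
Lemma nabla_phi_transverse x y z : g (nphi (phi (phi x)) (phi y)) (phi z) = 0.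
Proof.
pose G x y z := g (nphi (phi (phi x)) (phi y)) (phi z).
have Gskew a b c p : G a b c p = - G a c b p.
  by rewrite /G nabla_phi_skew metricC CinfNE.
have cyc a b c p : G a b c p - G b a c p + G c b a p = 0.
  have [hor _] := hS.
  have [+ _] := hor _ _ _ (phi_horizontal c) (phi_horizontal a)
    (phi_horizontal b).
  have [_ +] := hor _ _ _
    (phi_horizontal a) (phi_horizontal b) (phi_horizontal (phi c)).
  rewrite /nijenhuis phi_bracketE eta_dual phi_horizontal d_fundamentalE /G.
  rewrite (metricC g (phi b)) (metricC g (phi (phi c))) (metricC g (phi a)).
  rewrite (nabla_phi_skew _ (phi (phi c))) (metricC g (phi (phi c)) (nphi _ _)).
  rewrite (metricC g (phi c)) !metricE !(phi_skew (nphi _ _)).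
  by move=> /(Cinf_at p) + /(Cinf_at p); rewrite !CinfrE; lra.
apply: CinfP => p; rewrite -/(G x y z) Cinf0E.
have := cyc x y z p; have := cyc y z x p; have := cyc z x y p.
have := Gskew x y z p; have := Gskew y z x p; have := Gskew z x y p; lra.
Qed.

Lemma nabla_phi_eq x y : nphi x y =
  g x xi *: P y - g y xi *: phi (psi x) + g (phi (psi x)) y *: xi.
Proof.
apply: (@metric_ext _ _ _ g) => z p.
(* All three slots now carry [phi (phi _)], which is minus the horizontal projection; expanding by
   [phi2] leaves g(nphi x y, z) and terms with xi in some slot. *)
have := nabla_phi_transverse x (phi y) (phi z).
have nxi u v : g (nphi u v) xi = g (phi (psi u)) v.
  by rewrite nabla_phi_skew nabla_phi_xi metricNr opprK metricC.
rewrite !phi2 !nabla_phi_linE !nabla_phi_xi nabla_xi_xi -/(P y) !metricE !nxi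
  nabla_xi_xi !phiE.
rewrite !phi_horizontal !metricE.
move=> /(Cinf_at p); rewrite (metricC g xi z) !CinfrE; lra.
Qed.

Lemma phi_psi_phi_skew x y :
  g (phi (psi (phi x))) y = - g x (phi (psi (phi y))).
Proof. by rewrite phi_skew nabla_xi_skew phi_skew opprK. Qed.

(** The product of [P] and [phi] is skew because these skew operators anticommute. *)
Lemma gamma_endo_skew x y : g (Gam x) y = - g x (Gam y).
Proof.
have Pp : g (P (phi x)) y = - g x (P (phi y)).
  by rewrite nabla_xi_phi_skew phi_skew opprK nabla_xi_phi_phi metricNr opprK.
rewrite !gamma_endoE !metricE Pp phi_psi_phi_skew nabla_xi_skew.
by rewrite !opprD !opprK.
Qed.

Lemma gamma_endo_horizontal x : g (Gam x) xi = 0.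
Proof.
by rewrite !gamma_endoE !metricE nabla_xi_phi_horizontal phi_horizontal
  nabla_xi_horizontal !subr0 oppr0.
Qed.

Lemma gamma_endo_xi : Gam xi = 0.
Proof.
by rewrite gamma_endoE !nabla_xi_phiE !phiE !nabla_xiE !phiE !subr0 !oppr0.
Qed.

Lemma gammaE x y : gam x y = g (Gam x) y.
Proof.
rewrite /gamma d_fundamentalE nabla_phi_xi (metricC g y) (metricC g xi).
rewrite (nabla_phi_skew y) nabla_phi_xi gamma_endoE !metricE opprK phi_metricE.
rewrite nabla_xi_horizontal mulr0 subr0 nabla_xi_phi_skew opprK.
by rewrite (nabla_xi_skew x) opprK.
Qed.

Lemma phi_bracket_eq y z : phi_bracket S y z =
  (g (phi (psi (phi y))) z + g (phi (psi (phi y))) z) *: xi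
  - g y xi *: Gam z + g z xi *: Gam y.
Proof.
apply: (@metric_ext _ _ _ g) => x p.
rewrite phi_bracketE !nabla_phi_eq (phi_psi_phi_skew z y) (metricC g z (phi _)).
rewrite !gamma_endoE !nabla_xi_phiE !phiE !phi2 !metricE !phi_horizontal.
rewrite !nabla_xi_horizontal !CinfrE; lra.
Qed.

Lemma nijenhuisE x y z : N x y z = g x xi *
    (g (phi (psi (phi y))) z + g (phi (psi (phi y))) z
     + g (psi y) z + g (psi y) z)
  - g y xi * gam z x - g z xi * gam x y.
Proof.
rewrite /nijenhuis phi_bracket_eq d_etaE !gammaE (gamma_endo_skew x) eta_dual.
rewrite (metricC g (psi z)) (nabla_xi_skew y z).
apply: CinfP => p; rewrite !metricE (metricC g x (Gam z)) !CinfrE; lra.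
Qed.

Lemma d_eta_nabla_xi x y : d_one Dg eta x y = g (psi x) y + g (psi x) y.
Proof.
by rewrite d_etaE (nabla_xi_skew y) (metricC g y) opprK.
Qed.

(** On horizontal vectors [Gam] anticommutes with [phi]: so does the product of [P] and [phi], and
    phi psi phi + psi is twice the part of psi that anticommutes with [phi]. *)
Lemma gamma_endo_phi x y : g (Gam (phi x)) (phi y) = - g (Gam x) y.
Proof.
have pph w u : g (w) (phi u) = - g (phi w) u by rewrite phi_skew opprK.
apply: CinfP => p; rewrite pph !gamma_endoE phi2.
rewrite !(nabla_xi_phiE, nabla_xiE, phiE) !phi2 !metricE
  ?nabla_xi_phi_horizontal !nabla_xi_horizontal.
rewrite !CinfrE; lra.
Qed.

Lemma gamma_two_form : two_form gam.
Proof.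
split=> [z f x y|x y]; rewrite !gammaE.
  by rewrite !gamma_endo_skew !(metricC g _ (Gam z)) !metricE opprD mulrN.
by rewrite gamma_endo_skew metricC.
Qed.

Lemma gamma_nijenhuis x y : gam x y = N (phi x) (phi y) xi.
Proof.
rewrite nijenhuisE !phi_horizontal !mul0r subrr sub0r xi_xi mul1r.
by rewrite !gammaE gamma_endo_phi opprK.
Qed.

(** * The canonical connection: formula, compatibility and uniqueness *)

Lemma canonical_connection_formula x y z : g (Dc x y) z = g (Dg x y) z +
  (2^-1 : R) *: (wedge21 (fun u v => d_one Dg eta u v - gam u v) eta x y z
    - N x y z).
Proof.
rewrite /wedge21 nijenhuisE !d_eta_nabla_xi !gammaE !eta_dual.
rewrite (nabla_xi_skew z x) (metricC g z (psi x)) /canonical_connection.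
apply: CinfP => p; rewrite !metricE (metricC g xi z) !CinfrE; lra.
Qed.

Lemma canonical_metric_connection : metric_connection g Dc.
Proof.
have phiDc y : endomorphism (Dc^~ y).
  move=> f x x'; rewrite /canonical_connection.
  have [-> _ _] := connDg; apply: (@metric_ext _ _ _ g) => z p.
  rewrite !nabla_xiE !metricE !CinfrE; lra.
have GamD u v : Gam (u + v) = Gam u + Gam v.
  rewrite !gamma_endoE !(phiE, nabla_xiE, nabla_xi_phiE).
  apply: (@metric_ext _ _ _ g) => z p; rewrite !metricE !CinfrE; lra.
have GamZ f v : Gam (f *: v) = f *: Gam v.
  rewrite !gamma_endoE !(phiE, nabla_xiE, nabla_xi_phiE).
  apply: (@metric_ext _ _ _ g) => z p; rewrite !metricE !CinfrE; lra.
split; first split=> // [x y z|x f y].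
- rewrite /canonical_connection (connectionDr connDg) GamD !(phiE, nabla_xiE).
  apply: (@metric_ext _ _ _ g) => w p; rewrite !metricE !CinfrE; lra.
- rewrite /canonical_connection (connectionZr connDg) GamZ !(phiE, nabla_xiE).
  apply: (@metric_ext _ _ _ g) => w p; rewrite !metricE !CinfrE; lra.
move=> x y z; rewrite lc_metric /canonical_connection !metricE.
rewrite (metricC g y (Gam z)) (gamma_endo_skew z) (metricC g z (Gam y)).
rewrite (metricC g y (phi _)) (phi_psi_phi_skew z) (metricC g z (phi _)).
rewrite (metricC g xi z) (metricC g y xi) (metricC g y (psi x)).
apply: CinfP => p; rewrite !CinfrE; lra.
Qed.

(** For [phi], compare with [nabla_phi_eq]: the terms of [Dc] in g(psi x, y) xi and eta(y) psi x
    cancel those containing phi psi x, and the commutator of the last term with [phi] cancels eta(x)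
    P y. *)
Lemma canonical_compatible : compatible S Dc.
Proof.
have Dxi x : Dc x xi = 0.
  rewrite /canonical_connection gamma_endo_xi !phiE !nabla_xiE !phiE
    nabla_xi_horizontal xi_xi.
  apply: (@metric_ext _ _ _ g) => z p; rewrite !metricE !CinfrE /nabla_xi; lra.
split=> [//|x y|x y].
  rewrite /nabla_one !eta_dual.
  have [_ ->] := canonical_metric_connection.
  by rewrite Dxi metric0r addr0 subrr.
apply: (@metric_ext _ _ _ g) => z p.
have /(congr1 (fun u => g u z)) := nabla_phi_eq x y.
rewrite nabla_phiE /nabla_endo /canonical_connection !gamma_endoE.
move=> /(Cinf_at p);
  rewrite phi_horizontal !(phiE, nabla_xiE, nabla_xi_phiE) !phi2.
rewrite !(phiE, nabla_xiE, nabla_xi_phiE) !metricE !nabla_xi_horizontal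
  !nabla_xi_phi_horizontal.
rewrite (phi_skew (psi x) y).
rewrite !CinfrE; lra.
Qed.

Lemma wedge21_skew (b : vfield M -> vfield M -> Cinf M) x y z :
  (forall u v, b u v = - b v u) ->
  wedge21 b eta x y z + wedge21 b eta y x z = 0.
Proof.
move=> bs; rewrite /wedge21 (bs y x) (bs x z) (bs z y).
apply: CinfP => p; rewrite !CinfrE; lra.
Qed.

Lemma d_eta_skew x y : d_one Dg eta x y = - d_one Dg eta y x.
Proof. by rewrite /d_one [RHS]opprB. Qed.

Lemma gamma_skew x y : gam x y = - gam y x.
Proof. by have [_] := gamma_two_form; apply. Qed.

Lemma canonical_differenceE x y z : difference_tensor g Dg Dc x y z =
  (2^-1 : R) *: (wedge21 (fun u v => d_one Dg eta u v - gam u v) eta x y z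
    - N x y z).
Proof.
by rewrite /difference_tensor canonical_connection_formula addrC addKr.
Qed.

Lemma wedge_d_eta_gamma_skew x y z :
  wedge21 (fun u v => d_one Dg eta u v - gam u v) eta x y z +
  wedge21 (fun u v => d_one Dg eta u v - gam u v) eta y x z = 0.
Proof.
by apply: wedge21_skew => u v; rewrite d_eta_skew gamma_skew [RHS]opprD.
Qed.

Lemma canonical_skew : skew_modulo_nijenhuis S Dg Dc.
Proof.
move=> x y z; rewrite !canonical_differenceE.
have := wedge_d_eta_gamma_skew x y z.
move: (wedge21 _ _ _ _ _) (wedge21 _ _ _ _ _) (N _ _ _) (N _ _ _) => u v w t.
by move=> e; apply: CinfP => p; move/(Cinf_at p): e; rewrite !CinfrE; lra.
Qed.

(* The connections differ by a horizontal 3-form E with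
   E(x, phi y, z) = - E(x, y, phi z). Then E is invariant under applying phi to
   any two arguments, and doing so for the three pairs in turn gives E = - E. *)
Lemma compatible_skew_unique D D' :
  metric_connection g D -> compatible S D -> skew_modulo_nijenhuis S Dg D ->
  metric_connection g D' -> compatible S D' -> skew_modulo_nijenhuis S Dg D' ->
  D = D'.
Proof.
move=> mD [Dxi _ Dphi] sD mD' [D'xi _ D'phi] sD'.
pose E x y z := g (D x y) z - g (D' x y) z.
have E12 x y z : E x y z = - E y x z.
  move: (sD x y z) (sD' x y z); rewrite /difference_tensor /E.
  move: (N _ _ _) (N _ _ _) => u v e e'; apply: CinfP => p.
  move/(Cinf_at p): e; move/(Cinf_at p): e'; rewrite !CinfrE; lra.
have E23 x y z : E x y z = - E x z y.
  apply: CinfP => p.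
  have := difference_tensor_skew hDg mD x y z p.
  have := difference_tensor_skew hDg mD' x y z p.
  rewrite /difference_tensor /E !CinfrE; lra.
have Exi y z : E xi y z = 0.
  by rewrite E12 /E Dxi D'xi !metric0l subrr oppr0.
have Ephi x y z : E x (phi y) z = - E x y (phi z).
  have comm (D0 : vfield M -> vfield M -> vfield M) u v :
      nabla_endo D0 phi u v = 0 -> D0 u (phi v) = phi (D0 u v).
    by move/eqP; rewrite subr_eq0 => /eqP.
  by rewrite /E !comm// !phi_skew -opprD.
(* By [Exi] the xi-component in [phi2] contributes nothing. *)
have Elin x y z : E (phi (phi x)) y z = - E x y z.
  have [[Dl _ _] _] := mD; have [[Dl' _ _] _] := mD'.
  rewrite phi2 /E !(endoE (Dl y)) !(endoE (Dl' y)).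
  move/(congr1 (fun f => g x xi * f)): (Exi y z); rewrite /E mulr0 => e.
  by apply: CinfP => p; move/(Cinf_at p): e; rewrite !metricE !CinfrE; lra.
have cyc u v w : E u v w = E w u v by rewrite E23 E12 opprK.
have E0 x y z : E x y z = 0.
  have a u v w : E u (phi v) (phi w) = E u v w.
    have e1 : E u (phi v) (phi w) = - E u v (phi (phi w)) by exact: Ephi.
    by rewrite {}e1 cyc Elin opprK -cyc.
  have b u v w : E (phi u) v (phi w) = E u v w by rewrite E12 a -E12.
  have c u v w : E (phi u) (phi v) w = E u v w by rewrite E23 b -E23.
  have : - E x y z = E x y z by rewrite -Elin -a c b.
  by move=> e; apply: CinfP => p; move/(Cinf_at p): e; rewrite !CinfrE; lra.
apply/funext => x; apply/funext => y; apply: (@metric_ext _ _ _ g) => z p.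
by move/(Cinf_at p): (E0 x y z); rewrite /E !CinfrE; lra.
Qed.

(** * The symmetry types of the torsion and of N *)

Local Notation B :=
  (fun y z => g (phi (psi (phi y))) z + g (phi (psi (phi y))) z
              + g (psi y) z + g (psi y) z + gam y z).

Lemma nijenhuis_gamma x y z :
  N x y z + wedge21 gam eta x y z = eta x * B y z.
Proof.
rewrite nijenhuisE /wedge21 !eta_dual.
move: (gam x y) (gam y z) (gam z x) => a b c.
apply: CinfP => p; rewrite !CinfrE; lra.
Qed.

(** This and the next two lemmas conjugate the cyclicity relation by [phi]: psi and phi psi phi are
    exchanged up to sign, and phi P changes sign. *)
Lemma psi_phi_conj y z : g (psi (phi y)) (phi z) = - g (phi (psi (phi y))) z.
Proof. by rewrite phi_skew opprK. Qed.

Lemma phi_psi_phi_conj y z :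
  g (phi (psi (phi (phi y)))) (phi z) = - g (psi y) z.
Proof.
rewrite phi_metricE nabla_xi_horizontal mul0r subr0 phi2 !nabla_xiE scaler0
  addr0.
exact: metricNl.
Qed.

Lemma phi_P_conj y z : g (phi (P (phi y))) (phi z) = - g (phi (P y)) z.
Proof. by rewrite phi_metricE nabla_xi_phi_horizontal mul0r subr0
  nabla_xi_phi_phi metricNl. Qed.

(** The tensor eta(x) B(y, z) is now skew in x and y; at x = xi this gives B(y, z) = - eta(y) B(xi,
    z), which vanishes because [psi] and [Gam] kill xi. *)
Lemma totally_skew_nijenhuis :
  totally_skew N -> forall x y z, N x y z + wedge21 gam eta x y z = 0.
Proof.
move=> sN x y z; rewrite nijenhuis_gamma.
suff -> : B y z = 0 by rewrite mulr0.
have w := wedge21_skew xi y z gamma_skew.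
have := nijenhuis_gamma xi y z; have := nijenhuis_gamma y xi z.
rewrite [in X in _ -> X]eta_dual xi_xi mul1r.
rewrite !gammaE gamma_endo_xi (phi_xi S) nabla_xi0 phi0 nabla_xi_xi !metric0l
  !addr0 mulr0.
move: w (sN xi y z).
move: (N xi y z) (N y xi z) (wedge21 _ _ _ _ _) (wedge21 _ _ _ _ _).
move=> u v t t' e2 e0 e1 <-; apply: CinfP => p.
move/(Cinf_at p): e0; move/(Cinf_at p): e1; move/(Cinf_at p): e2.
rewrite !CinfrE; lra.
Qed.

(** The difference tensor is - N/2 plus a 3-form. *)
Lemma canonical_torsion_totally_skewP :
  torsion_totally_skew (torsion g Dc) <-> totally_skew N.
Proof.
rewrite (torsion_totally_skewP hDg canonical_metric_connection).
split=> H x y z; move: (H x y z); rewrite !canonical_differenceE;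
  have := wedge_d_eta_gamma_skew x y z;
  move: (wedge21 _ _ _ _ _) (wedge21 _ _ _ _ _) (N _ _ _) (N _ _ _);
  move=> u v s t eu es; apply: CinfP => p;
  by move/(Cinf_at p): eu; move/(Cinf_at p): es; rewrite !CinfrE; lra.
Qed.

(** Applying [phi] to both arguments changes the sign of gamma, hence also of d eta, which is 2
    g(psi x, y). *)
Lemma d_eta_gamma_operators : (forall x y, d_one Dg eta x y = gam x y) ->
  forall x y, g (phi (psi (phi x))) y = g (psi x) y.
Proof.
move=> h x y; apply: CinfP => p.
have := h (phi x) (phi y); have := h x y.
rewrite !d_eta_nabla_xi !gammaE gamma_endo_phi !gamma_endoE !metricE
  psi_phi_conj.
rewrite nabla_xi_phi_phi !metricE.
move=> /(Cinf_at p) + /(Cinf_at p); rewrite !CinfrE; lra.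
Qed.

Lemma nijenhuis_traceless_cyclic :
  (forall x y, d_one Dg eta x y = gam x y) -> traceless_cyclic g N.
Proof.
move=> h; have b := d_eta_gamma_operators h.
have NE x y z : N x y z = g x xi * (g (psi y) z + g (psi y) z
    + g (psi y) z + g (psi y) z) - g y xi * (g (psi z) x + g (psi z) x)
    - g z xi * (g (psi x) y + g (psi x) y).
  by rewrite nijenhuisE b -!h !d_eta_nabla_xi.
have psi_diag x p : g (psi x) x p = 0.
  have /(Cinf_at p) := nabla_xi_skew x x; rewrite (metricC g x) !CinfrE; lra.
split=> [x y z|U e oU fe x q Uq].
  by rewrite !NE; apply: CinfP => p; rewrite !CinfrE; lra.
have := orthonormal_frame_metric xi (psi x) fe Uq.
rewrite metricC nabla_xi_horizontal Cinf0E => tr.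
(* The coefficients 4 and -2 of [NE] both contribute negatively, by skewness of [psi] and directly;
   the eta(x) term vanishes by [psi_diag]. The sum is then -6 g(xi, psi x) = 0. *)
transitivity (\sum_(i < n) - 6 * (g xi (e i) q * g (e i) (psi x) q)).
  apply: eq_bigr => i _; rewrite NE (nabla_xi_skew (e i) x).
  rewrite (metricC g (psi x)) (metricC g xi) !CinfrE psi_diag; lra.
by rewrite -big_distrr /= -tr mulr0.
Qed.

Lemma canonical_torsion_traceless_cyclicP :
  torsion_traceless_cyclic g (torsion g Dc) <->
  (forall x y, d_one Dg eta x y = gam x y).
Proof.
rewrite (torsion_traceless_cyclicP hDg canonical_metric_connection).
split=> [[cyc _] x y|h].
  have key u v p : 5 * g (psi u) v p =
      g (phi (psi (phi u))) v p + g (phi (P u)) v p.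
    have /(Cinf_at p) := cyc xi u v.
    rewrite !canonical_differenceE /wedge21 !nijenhuisE !d_eta_nabla_xi !gammaE.
    rewrite !eta_dual !(gamma_endo_xi, phiE, nabla_xiE) xi_xi.
    rewrite !nabla_xi_horizontal !phi_horizontal !gamma_endo_horizontal.
    rewrite !gamma_endoE !nabla_xi_phiE !metricE !CinfrE; lra.
  (* The second instance reads 5 phi psi phi = psi + phi P; subtracting it from the first gives 6
     (psi - phi psi phi) = 0. *)
  apply: CinfP => p; have := key x y p; have := key (phi x) (phi y) p.
  rewrite psi_phi_conj phi_psi_phi_conj phi_P_conj d_eta_nabla_xi gammaE
    gamma_endoE.
  rewrite nabla_xi_phi_phi !metricE !CinfrE; lra.
have [cyc tr] := nijenhuis_traceless_cyclic h.
have AE x y z : difference_tensor g Dg Dc x y z = (- 2^-1 : R) *: N x y z.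
  rewrite canonical_differenceE /wedge21 !h !subrr !mul0r !add0r.
  by rewrite scalerN scaleNr.
split=> [x y z|U e oU fe x q Uq]; first by rewrite !AE -!scalerDr cyc scaler0.
under eq_bigr do rewrite AE CinfZE.
by rewrite -big_distrr /= (tr U e oU fe x q Uq) mulr0.
Qed.

End AlmostContactGeometry.

Theorem theorem3p1 (R : realType) (M : smooth_manifold R 5)
    (g : riemannian_metric M) (Dg : vfield M -> vfield M -> vfield M)
    (hDg : levi_civita g Dg) (S : almost_contact_metric g)
    (hS : generalized_quasi_sasaki S Dg) :
  let eta := acm_eta S in
  let xi := acm_xi S in
  let phi := acm_phi S in
  let Phi := fundamental_form S in
  let N := nijenhuis S Dg in
  let deta := d_one Dg eta in
  let gam := gamma S Dg in
  exists Dc : vfield M -> vfield M -> vfield M,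
    [/\ metric_connection g Dc /\ compatible S Dc,
        (forall D : vfield M -> vfield M -> vfield M,
           metric_connection g D -> compatible S D ->
           skew_modulo_nijenhuis S Dg D -> D = Dc),
        [/\ (forall X Y Z : vfield M,
               g (Dc X Y) Z = g (Dg X Y) Z
                 + (2^-1 : R) *: (wedge21 (fun U V => deta U V - gam U V) eta X Y Z
                                  - N X Y Z)),
            two_form gam
          & forall X Y : vfield M,
              gam X Y = d_two Dg Phi xi (phi X) Y /\
              gam X Y = N (phi X) (phi Y) xi],
        (torsion_totally_skew (torsion g Dc) <-> totally_skew N) /\
        (totally_skew N ->
           forall X Y Z : vfield M, N X Y Z + wedge21 gam eta X Y Z = 0)
      & (torsion_traceless_cyclic g (torsion g Dc) <->
           (forall X Y : vfield M, deta X Y = gam X Y)) /\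
        ((forall X Y : vfield M, deta X Y = gam X Y) ->
           traceless_cyclic g N)].
Proof.
move=> eta xi phi Phi N deta gam.
have mDc := canonical_metric_connection hDg hS.
have cDc := canonical_compatible hDg hS.
exists (canonical_connection Dg S); split.
- by split.
- move=> D mD cD sD.
  exact (compatible_skew_unique hDg mD cD sD mDc cDc (canonical_skew hDg hS)).
- split; first exact (canonical_connection_formula hDg hS).
    exact (gamma_two_form hDg hS).
  by move=> X Y; split=> //; exact (gamma_nijenhuis hDg hS X Y).
- split; first exact (canonical_torsion_totally_skewP hDg hS).
  exact (totally_skew_nijenhuis hDg hS).
- split; first exact (canonical_torsion_traceless_cyclicP hDg hS).
  exact (nijenhuis_traceless_cyclic hDg hS).
Qed.
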